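(* Let $k$ be an algebraically closed field of characteristic zero and let $n\ge 1$. For integers $1\leq a_1\leq\ldots\leq a_n$ consider the monomial \[M=x_1^{a_1}\cdot\ldots\cdot x_n^{a_n}\in k[x_1,\ldots,x_n],\] let $d=a_1+\ldots+a_n$ be its degree, and for $i=2,\ldots,n$ let $\mathcal{Z}(i)=\{z\in k : z^{a_i+1}=1\}$. Then there exist scalars $\gamma_{\epsilon(2),\ldots,\epsilon(n)}\in k$, indexed by the tuples $(\epsilon(2),\ldots,\epsilon(n))\in\mathcal{Z}(2)\times\ldots\times\mathcal{Z}(n)$, such that \[M=\sum_{\epsilon(i)\in\mathcal{Z}(i),\ i=2,\ldots,n}\gamma_{\epsilon(2),\ldots,\epsilon(n)}\left(x_1+\epsilon(2)x_2+\ldots+\epsilon(n)x_n\right)^d,\] and this decomposition involves the least number of summands, i.e. its number of summands is equal to $\mathrm{rk}(M)$.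
   Context: For a homogeneous polynomial (form) $F$ of degree $d$ in $k[x_1,\ldots,x_n]$, the Waring rank $\mathrm{rk}(F)$ is the least integer $s$ for which there exist linear forms $L_1,\ldots,L_s\in k[x_1,\ldots,x_n]$ such that $F=\sum_{i=1}^s L_i^d$. *)

(* Defs.v *)
From HB Require Import structures.
From mathcomp Require Import all_boot all_order all_algebra.
From mathcomp Require Import mpoly.

Set Implicit Arguments.
Unset Strict Implicit.
Unset Printing Implicit Defensive.

Import GRing.Theory.
Local Open Scope ring_scope.

(* The exponent is [m.+1], not [m], so that the set of solutions is finite for
   every [m]; this is what allows the [finType] instance below. *)
Record unity_root (k : closedFieldType) (m : nat) := UnityRoot {
  unity_root_val :> k;
  unity_root_prop : unity_root_val ^+ m.+1 == 1
}.

Section UnityRootFinite.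
Variables (k : closedFieldType) (m : nat).

HB.instance Definition _ := [isSub for @unity_root_val k m].
HB.instance Definition _ := [Choice of unity_root k m by <:].

Let rs : seq k := sval (closed_field_poly_normal ('X^(m.+1) - 1)).

Fact mem_unity_roots (z : k) : (z \in rs) = (z ^+ m.+1 == 1).
Proof.
rewrite /rs; case: closed_field_poly_normal => r /= Er.
have lc : lead_coef ('X^(m.+1) - 1 : {poly k}) = 1.
  by rewrite -[1]/(1%:P : {poly k}) lead_coefXnsubC.
move: Er; rewrite lc scale1r => Er.
by rewrite -root_prod_XsubC -Er rootE !hornerE subr_eq0.
Qed.

Fact unity_root_in (z : unity_root k m) : val z \in rs.
Proof. by rewrite mem_unity_roots (valP z). Qed.

Let to_rs (z : unity_root k m) : seq_sub rs := SeqSub (unity_root_in z).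

Let of_rs (z : seq_sub rs) : unity_root k m :=
  @UnityRoot k m (ssval z)
    (etrans (esym (mem_unity_roots (ssval z))) (ssvalP z)).

Fact to_rsK : cancel to_rs of_rs.
Proof. by move=> z; apply: val_inj. Qed.

HB.instance Definition _ : isCountable (unity_root k m) :=
  CanIsCountable to_rsK.
HB.instance Definition _ : isFinite (unity_root k m) :=
  CanIsFinite to_rsK.

End UnityRootFinite.

Definition waring_decomposable (k : fieldType) (n d : nat)
    (F : {mpoly k[n]}) (s : nat) : Prop :=
  exists L : 'I_s -> {mpoly k[n]},
    (forall i, L i \is 1.-homog) /\ F = \sum_(i < s) L i ^+ d.

(* [is_waring_rank d F s] says that rk(F) = s for a form [F] of degree [d].  The
   rank is a relation because a decomposition need not exist over an arbitrary
   field. *)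
Definition is_waring_rank (k : fieldType) (n d : nat)
    (F : {mpoly k[n]}) (s : nat) : Prop :=
  waring_decomposable d F s /\
  forall t : nat, waring_decomposable d F t -> (s <= t)%N.

(* Tuples in Z(2) x ... x Z(N) for N = n.+1 >= 1 variables.  Indices start at 0:
   [ord0] stands for 1, and [lift ord0 i] with [i : 'I_n] runs over 2, ..., N. *)
Definition unity_tuple (k : closedFieldType) (n : nat) (a : 'I_n.+1 -> nat) :=
  {dffun forall i : 'I_n, unity_root k (a (lift ord0 i))}.

(* Main.v *)
Require Import Defs.
From mathcomp Require Import all_boot all_order all_algebra.
From mathcomp Require Import separable cyclotomic.
From mathcomp Require Import mpoly ring.

Import GRing.Theory.
Local Open Scope ring_scope.

(** Write [p ^ m] for the product of the [p_j ^ m_j].  Everything rests on one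
    formula, [mcoeff_linear_form_exp]: the coefficient of [X^m] in the [d]-th
    power of the linear form with coefficient vector [p] is a multinomial
    coefficient, nonzero in characteristic zero when [|m| = d], times [p ^ m].
    Hence a sum of [d]-th powers of forms [p_1, ..., p_t] equals [x^a] exactly
    when the moments [p_1 ^ m + ... + p_t ^ m] vanish for all [m] of degree
    [d] other than [a], with the right nonzero value at [m = a].

    Existence: weight the form with coefficients [(1, e_1, ..., e_n)] by the
    product of the [e_i], which cancels [e_1^a_1 ... e_n^a_n] because
    [e_i^(a_i + 1) = 1], and by a normalizing constant.  The moments then factor
    into sums of powers of roots of unity, and so select the [m] with
    [m_i = a_i] modulo [a_i + 1] for [i >= 1].  Since [a_0] is the smallest
    exponent, the only such [m] of degree [d] is [a] itself
    ([eq_of_dvdn_succ]).  Scalars are absorbed into the linear forms by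
    extracting [d]-th roots.

    Minimality ([monomial_waring_ge]): suppose that [t] forms suffice, with [t]
    smaller than the product of the [a_i + 1], [i >= 1].  That product counts
    the monomials [y_1^b_1 ... y_n^b_n] with [b <= a], so some nonzero linear
    combination [f] of them vanishes at those of the [t] points that lie in the
    chart [y_0 = 1].  If [g] is the homogenization of [f] by [y_0], then
    [y_0 g] vanishes at all [t] points, including those at infinity; multiplied
    by any monomial that brings its degree to [d], it gives a linear relation
    between the moments.  Take a monomial [y^e] of top degree in [f], and the
    multiplier [y_0^(a_0 - 1) y^(a - e)], which makes sense because [a_0 >= 1].
    The moment at [a] appears in the resulting relation with the coefficient
    of [y^e] in [f], and all others are zero: a contradiction. *)

(** * Families indexed by dependent tuples *)

(** Distributivity of products over sums when the index set of the sum depends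
    on the factor: the sums over tuples of roots of unity factor this way. *)
Lemma bigA_distr_dffun (R : comPzSemiRingType) (I : finType)
    (T_ : I -> finType) (F : forall i, T_ i -> R) :
  \prod_i \sum_(j : T_ i) F i j =
  \sum_(f : {dffun forall i, T_ i}) \prod_i F i (f i).
Proof.
rewrite (reindex (@dffun_of_fprod I T_)) /=; last first.
  exact/onW_bij/dffun_of_fprod_bij.
pose P i := [ffun j : T_ i => F i j].
transitivity (\sum_(t : fprod T_) \prod_(i in I) P i (t i)); last first.
  by apply: eq_bigr => t _; apply: eq_bigr => i _; rewrite !ffunE.
rewrite big_fprod.
rewrite -(bigA_distr_big_dep (fun i => tagged_with T_ i)
  (fun i => untag 0 (P i))).
apply: eq_bigr => i _.
rewrite -(big_tag (fun i => P i)).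
by apply: eq_bigr => j _; rewrite ffunE.
Qed.

Lemma card_dffun (I : finType) (T_ : I -> finType) :
  #|{dffun forall i, T_ i}| = (\prod_i #|T_ i|)%N.
Proof.
by rewrite -card_fprod; apply/esym/bij_eq_card/dffun_of_fprod_bij.
Qed.

(** * Coefficients of powers of linear forms *)

(** The multinomial coefficient [d! / (m_1! ... m_n!)], as the number of words
    of length [d] in which the letter [i] occurs [m i] times.  Expanding a
    [d]-th power of a sum produces this count directly. *)
Definition words {n : nat} (d : nat) (m : 'X_{1..n}) : nat :=
  #|[pred f : {ffun 'I_d -> 'I_n} | (\sum_j U_(f j))%MM == m]|.

Lemma words_gt0 {n : nat} (d : nat) (m : 'X_{1..n}) :
  (0 < words d m)%N = (mdeg m == d).
Proof.
apply/idP/eqP => [/card_gt0P[f /eqP <-]|degm].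
  rewrite mdeg_sum (eq_bigr (fun=> 1%N)) => [|j _]; last exact: mdeg1.
  by rewrite sum1_card card_ord.
suff [f fm] : exists f : {ffun 'I_d -> 'I_n},
    (\sum_j U_(f j))%MM = m by apply/card_gt0P; exists f; rewrite inE fm.
elim: d m degm => [|d IHd] m degm.
  exists [ffun i : 'I_0 => False_rect _ (notF (ltn_ord i))].
  by rewrite big_ord0; apply/esym/eqP; rewrite -mdeg_eq0 degm.
have [i mi_gt0] : exists i, (0 < m i)%N.
  apply/existsP; apply: contraTT isT => /existsPn m_le0.
  by move: degm; rewrite mdegE big1 // => i _; apply/eqP; rewrite eqn0Ngt.
have mE : (m - U_(i) + U_(i))%MM = m.
  by rewrite submK //; apply/mnm_lepP => j; rewrite mnm1E; case: eqP => [<-|].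
have [|f fm] := IHd (m - U_(i))%MM.
  by apply: succn_inj; rewrite -degm -[in RHS]mE mdegD mdeg1 addn1.
(* Prepend the letter [i] to the word [f]. *)
exists [ffun j => if unlift ord0 j is Some j' then f j' else i].
rewrite big_ord_recl ffunE unlift_none -[RHS]mE -fm addmC; congr (_ + _)%MM.
by apply: eq_bigr => j _; rewrite ffunE liftK.
Qed.

(** The multinomial theorem: expand the power into a sum over words and collect
    the words with the same content. *)
Lemma mcoeff_linear_form_exp (R : comNzRingType) (n d : nat) (c : 'I_n -> R)
    (m : 'X_{1..n}) :
  ((\sum_i c i *: 'X_i) ^+ d)@_m = (words d m)%:R * \prod_i c i ^+ m i.
Proof.
rewrite -[d in _ ^+ d]card_ord -prodr_const bigA_distr_bigA /= raddf_sum /=.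
rewrite /words -sum1_card natr_sum mulr_suml [RHS]big_mkcond /=.
apply: eq_bigr => f _; rewrite scaler_prod mprodXE mcoeffZ mcoeffX inE.
case: eqP => [<-|_]; last by rewrite mulr0.
rewrite mulr1 mul1r.
under [RHS]eq_bigr => i _ do rewrite mnm_sumE expr_sum.
rewrite exchange_big /=; apply: eq_bigr => j _.
rewrite (bigD1 (f j)) //= mnm1E eqxx expr1 big1 ?mulr1 // => i.
by rewrite mnm1E eq_sym => /negPf->.
Qed.

Lemma linear_formE (R : nzRingType) (n : nat) (L : {mpoly R[n]}) :
  L \is 1.-homog -> L = \sum_i L@_U_(i) *: 'X_i.
Proof.
move=> Lhom; apply/mpolyP => m; rewrite raddf_sum /=.
under eq_bigr => i _ do rewrite mcoeffZ mcoeffX.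
have [/mdeg1P[i /eqP ->]|m_neq1] := boolP (mdeg m == 1%N).
  rewrite (bigD1 i) //= eqxx mulr1 big1 ?addr0 // => j /negPf j_neq_i.
  by rewrite eq_mnm1 j_neq_i mulr0.
rewrite (dhomog_nemf_coeff Lhom m_neq1) big1 // => i _.
case: eqP => [Um|_]; last by rewrite mulr0.
by move: m_neq1; rewrite -Um mdeg1.
Qed.

(** * Roots of unity *)

(** [X^(m+1) - 1] splits over [k], and it is separable because [m + 1] is
    invertible. *)
Lemma card_unity_root (k : closedFieldType) (m : nat) :
  m.+1%:R != 0 :> k -> #|{: unity_root k m}| = m.+1.
Proof.
move=> m_neq0; have /separable_Xn_sub_1 := m_neq0.
have [rs Ers] := closed_field_poly_normal ('X^(m.+1) - 1 : {poly k}).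
have lc : lead_coef ('X^(m.+1) - 1 : {poly k}) = 1.
  by rewrite -[1]/(1%:P : {poly k}) lead_coefXnsubC.
move: Ers; rewrite lc scale1r => Ers.
rewrite Ers separable_prod_XsubC => rs_uniq.
have sz_rs : size rs = m.+1.
  apply/eqP; rewrite -eqSS -(size_prod_XsubC rs id) -Ers.
  by rewrite -[1]/(1%:P : {poly k}) size_XnsubC.
rewrite -sz_rs cardE -(size_map val); apply/perm_size/uniq_perm => //.
  by rewrite map_inj_uniq ?enum_uniq //; apply: val_inj.
move=> z; rewrite -[RHS]root_prod_XsubC -Ers rootE !hornerE subr_eq0.
apply/mapP/idP => [[w _ ->]|zP]; first exact: (valP w).
by exists (UnityRoot zP); rewrite ?mem_enum.
Qed.

(** Unless all summands are 1, multiplication by some root [w] with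
    [w ^ j != 1] permutes the roots and multiplies the sum by [w ^ j].  Such a
    [w] exists since [X^r - 1], with [r = j mod m+1], has at most [r < m + 1]
    roots. *)
Lemma sum_unity_root_exp (k : closedFieldType) (m j : nat) :
  m.+1%:R != 0 :> k ->
  \sum_(z : unity_root k m) (z : k) ^+ j = (m.+1 %| j)%:R * m.+1%:R.
Proof.
move=> m_neq0; have cardU := card_unity_root _ _ m_neq0.
have expU (z : unity_root k m) : (z : k) ^+ j = (z : k) ^+ (j %% m.+1).
  by rewrite {1}(divn_eq j m.+1) exprD mulnC exprM (eqP (valP z)) expr1n mul1r.
rewrite /dvdn; have [j0|r_neq0] := eqVneq (j %% m.+1)%N 0%N.
  under eq_bigr => z _ do rewrite expU j0 expr0.
  by rewrite sumr_const cardU mul1r.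
have := ltn_pmod j (ltn0Sn m); rewrite mul0r.
set r := (j %% m.+1)%N in r_neq0 expU * => r_ltm.
have [w w_neq1] : exists w : unity_root k m, (w : k) ^+ r != 1.
  apply/existsP; apply: contraLR r_ltm => /existsPn allU; rewrite -leqNgt.
  have Xr_neq0 : 'X^r - 1 != 0 :> {poly k}.
    by rewrite -size_poly_gt0 -[1]/(1%:P : {poly k}) size_XnsubC ?lt0n.
  have := max_poly_roots Xr_neq0
    (rs := map (@unity_root_val k m) (enum {: unity_root k m})).
  rewrite size_map -cardE cardU -[1]/(1%:P : {poly k}) size_XnsubC ?lt0n //.
  apply; last by rewrite map_inj_uniq ?enum_uniq //; apply: val_inj.
  apply/allP => _ /mapP[z _ ->]; rewrite rootE !hornerE subr_eq0.
  by have := allU z; rewrite negbK.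
have mulP (z : unity_root k m) : ((w : k) * (z : k)) ^+ m.+1 == 1.
  by rewrite exprMn (eqP (valP w)) (eqP (valP z)) mulr1.
have mulI : injective (fun z => UnityRoot (mulP z)).
  move=> x y /(congr1 val) /= /mulfI xy; apply/val_inj/xy.
  apply: contraTneq (unity_root_prop w) => ->.
  by rewrite expr0n eq_sym oner_eq0.
set S := LHS; have : (w : k) ^+ r * S = S.
  rewrite mulr_sumr /S [RHS](reindex_inj mulI); apply: eq_bigr => z _.
  by rewrite (expU (UnityRoot (mulP z))) expU /= exprMn.
move/eqP; rewrite -subr_eq0 -{2}[S]mul1r -mulrBl mulf_eq0 subr_eq0.
by rewrite (negPf w_neq1) /= => /eqP.
Qed.

(** * Lower bound for the rank of a monomial *)

(** Fewer points than functions: the evaluation matrix has a left kernel. *)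
Lemma vanishing_combination (F : fieldType) (I : finType) (t : nat)
    (ev : I -> 'I_t -> F) :
  (t < #|I|)%N ->
  exists2 f : I -> F, (exists b, f b != 0) &
    forall i, \sum_b f b * ev b i = 0.
Proof.
move=> lt_t; pose A := \matrix_(r < #|I|, i < t) ev (enum_val r) i.
have : kermx A != 0.
  by rewrite kermx_eq0 /row_free neq_ltn (leq_ltn_trans (rank_leq_col A)).
case/rowV0Pn => v /sub_kermxP vA /rV0Pn[r vr].
exists (fun b => v 0 (enum_rank b)).
  by exists (enum_val r); rewrite enum_valK.
move=> i; have /rowP/(_ i) := vA; rewrite !mxE => vAi.
rewrite -[RHS]vAi (reindex (@enum_val _ I)) /=; last exact/onW_bij/enum_val_bij.
by apply: eq_bigr => s _; rewrite enum_valK mxE.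
Qed.

(** If [t] were smaller, some nonzero polynomial with monomials below
    [y_1^a_1 ... y_n^a_n] would vanish at all the affine points; the extra
    factor [y_0], which kills the points at infinity, is affordable because
    [a ord0 > 0]. *)
Lemma monomial_waring_ge (k : fieldType) (hchar : [pchar k] =i pred0)
    (n : nat) (a : 'I_n.+1 -> nat) (t : nat) :
  (0 < a ord0)%N ->
  waring_decomposable (\sum_i a i)
    (\prod_i 'X_i ^+ a i : {mpoly k[n.+1]}) t ->
  (\prod_(i < n) (a (lift ord0 i)).+1 <= t)%N.
Proof.
move=> a0_gt0 [L [Lhom eqM]]; set d := (\sum_i a i)%N in eqM.
pose am : 'X_{1..n.+1} := [multinom a i | i < n.+1].
pose p i j := (L i)@_U_(j).
pose moment (m : 'X_{1..n.+1}) := \sum_i \prod_j p i j ^+ m j.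
have power_sums m : (words d m)%:R * moment m = (m == am)%:R.
  transitivity ('X_[am] : {mpoly k[n.+1]})@_m; last by rewrite mcoeffX eq_sym.
  rewrite mpolyXE_id; under eq_bigr => i _ do rewrite mnmE.
  rewrite eqM raddf_sum mulr_sumr; apply: eq_bigr => i _ /=.
  by rewrite -mcoeff_linear_form_exp -linear_formE.
have moment_am : moment am != 0.
  apply: contra_eq_neq (power_sums am) => ->.
  by rewrite mulr0 eqxx eq_sym oner_eq0.
have moment_eq0 m : mdeg m = d -> m != am -> moment m = 0.
  move=> degm /negPf m_neq; have /eqP := power_sums m.
  rewrite m_neq mulf_eq0 (proj1 (pcharf0P k) hchar) => /orP[|/eqP //].
  by rewrite eqn0Ngt words_gt0 degm eqxx.
rewrite leqNgt; apply/negP => lt_t.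
pose B := {dffun forall i : 'I_n, 'I_(a (lift ord0 i)).+1}.
(* The monomial [y^b] at the [i]-th point in the chart [y_0 = 1].  A point with
   [p i ord0 = 0] gets a meaningless value, which is harmless: it is multiplied
   below by a positive power of [p i ord0]. *)
pose ev (b : B) i := \prod_j (p i (lift ord0 j) / p i ord0) ^+ b j.
have [|f [b0 fb0] f_ev] := vanishing_combination _ _ _ ev.
  by rewrite card_dffun; under eq_bigr => i _ do rewrite card_ord.
pose wt (b : B) := (\sum_j b j)%N.
have [e fe wt_max] :
    exists2 e, f e != 0 & forall b, f b != 0 -> (wt b <= wt e)%N.
  case: (@arg_maxnP _ b0 (fun b => f b != 0) wt fb0) => e fe wt_max.
  by exists e.
(* The term of [y_0 g] coming from [y^b] is [y_0^(1 + |e| - |b|) y^b]; times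
   [y_0^(a_0 - 1) y^(a - e)] it becomes the monomial with exponent [mm b]. *)
pose mm (b : B) : 'X_{1..n.+1} := [multinom if unlift ord0 i is Some j
    then (b j + (a i - e j))%N else ((wt e - wt b) + a ord0)%N | i < n.+1].
have mm0 b : mm b ord0 = ((wt e - wt b) + a ord0)%N.
  by rewrite mnmE unlift_none.
have mmS b j : mm b (lift ord0 j) = (b j + (a (lift ord0 j) - e j))%N.
  by rewrite mnmE liftK.
have e_le j : (e j <= a (lift ord0 j))%N by rewrite -ltnS.
have mm_deg b : f b != 0 -> mdeg (mm b) = d.
  move=> /wt_max le_b; rewrite mdegE /d !big_ord_recl mm0.
  under eq_bigr => j _ do rewrite mmS.
  rewrite big_split /= -/(wt b) addnC addnACA subnKC // addnA addnC.
  congr (_ + _)%N; rewrite /wt -big_split /=.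
  by apply: eq_bigr => j _; rewrite subnKC.
have mm_neq b : b != e -> mm b != am.
  apply: contraNneq => mm_am; apply/eqP/ffunP => j; apply: val_inj.
  apply: (@addIn (a (lift ord0 j) - e j)%N); rewrite /= [RHS]subnKC //.
  by rewrite -mmS mm_am mnmE.
have mm_e : mm e = am.
  apply/mnmP => i; rewrite [RHS]mnmE; case: (unliftP ord0 i) => [j|] ->.
    by rewrite mmS subnKC.
  by rewrite mm0 subnn.
(* At each point, [y^(mm b)] is [ev b] times a factor [K] independent of [b]. *)
have : \sum_b f b * moment (mm b) = 0.
  pose K i := p i ord0 ^+ (wt e + a ord0) *
    \prod_j p i (lift ord0 j) ^+ (a (lift ord0 j) - e j).
  transitivity (\sum_i K i * \sum_b f b * ev b i); last first.
    by rewrite big1 // => i _; rewrite f_ev mulr0.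
  under [RHS]eq_bigr => i _ do rewrite mulr_sumr.
  rewrite exchange_big /=; apply: eq_bigr => b _; rewrite mulr_sumr.
  apply: eq_bigr => i _; rewrite mulrCA.
  have [->|/wt_max le_b] := eqVneq (f b) 0; first by rewrite !mul0r.
  congr (_ * _); rewrite big_ord_recl mm0 /K /ev.
  under [X in _ * X = _]eq_bigr => j _ do rewrite mmS exprD.
  rewrite big_split /=; have [->|p0_neq0] := eqVneq (p i ord0) 0.
    by rewrite !expr0n !addn_eq0 (gtn_eqF a0_gt0) !andbF !mul0r.
  under [X in _ = _ * X]eq_bigr => j _ do rewrite expr_div_n.
  rewrite prodf_div -expr_sum -/(wt b) -{2}(subnK le_b) -addnA (addnC (wt b)).
  rewrite addnA; have w_neq0 := expf_neq0 (wt b) p0_neq0.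
  apply: (mulIf w_neq0); rewrite -[RHS]mulrA divfK // mulrAC.
  by rewrite -exprD [X in _ * X = _]mulrC mulrA.
rewrite (bigD1 e) //= mm_e big1 ?addr0 => [/eqP|b b_neq].
  by rewrite mulf_eq0 (negPf fe) (negPf moment_am).
have [->|fb] := eqVneq (f b) 0; first by rewrite mul0r.
by rewrite moment_eq0 ?mulr0 ?mm_deg ?mm_neq.
Qed.

(** * Decomposition by a root of unity filter *)

(** The divisibility forces [m j >= a j] for [j >= 1], so the total excess is at
    most [a 0] because the sums agree.  Each excess is a multiple of [a j + 1],
    which exceeds [a 0], and is therefore zero. *)
Lemma eq_of_dvdn_succ (n : nat) (a m : 'I_n.+1 -> nat) :
  (forall j : 'I_n, a ord0 <= a (lift ord0 j))%N ->
  (\sum_i m i = \sum_i a i)%N ->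
  (forall j : 'I_n, (a (lift ord0 j)).+1 %| (m (lift ord0 j)).+1)%N ->
  m =1 a.
Proof.
move=> a0_min; rewrite !big_ord_recl => sum_eq dvd_m.
have le_am j : (a (lift ord0 j) <= m (lift ord0 j))%N.
  by rewrite -ltnS; apply: dvdn_leq (dvd_m j).
have sum_m : (\sum_(j < n) m (lift ord0 j) = \sum_(j < n) a (lift ord0 j) +
    \sum_(j < n) (m (lift ord0 j) - a (lift ord0 j)))%N.
  by rewrite -big_split; apply: eq_bigr => j _ /=; rewrite subnKC.
have sum_excess : (m ord0 +
    \sum_(j < n) (m (lift ord0 j) - a (lift ord0 j)) = a ord0)%N.
  by apply/eqP; rewrite -(eqn_add2r (\sum_(j < n) a (lift ord0 j))) -sum_eq
    sum_m addnAC -addnA.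
have eq_tail j : m (lift ord0 j) = a (lift ord0 j).
  apply/eqP; rewrite eqn_leq le_am andbT -subn_eq0.
  apply: contraTT (a0_min j); rewrite -lt0n -ltnNge => excess_gt0.
  have dvd_excess :
      ((a (lift ord0 j)).+1 %| m (lift ord0 j) - a (lift ord0 j))%N.
    by rewrite -subSS dvdn_sub.
  apply: leq_trans (dvdn_leq excess_gt0 dvd_excess) _.
  by rewrite -sum_excess (bigD1 j) //= addnCA leq_addr.
move=> i; case: (unliftP ord0 i) => [j|] -> //.
by rewrite -sum_excess big1 ?addn0 // => j _; rewrite eq_tail subnn.
Qed.

Lemma expr_closed_surj (k : closedFieldType) (d : nat) (g : k) :
  (0 < d)%N -> exists r : k, r ^+ d = g.
Proof.
case: d => // d _.
have /closed_rootP[r] : size ('X^(d.+1) - g%:P : {poly k}) != 1%N.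
  by rewrite size_XnsubC.
by rewrite rootE !hornerE subr_eq0 => /eqP; exists r.
Qed.

Theorem proposition4p3 (k : closedFieldType) (hchar : [pchar k] =i pred0)
    (n : nat) (a : 'I_n.+1 -> nat)
    (ha1 : (1 <= a ord0)%N)
    (ha : forall i j : 'I_n.+1, (i <= j)%N -> (a i <= a j)%N) :
  let M : {mpoly k[n.+1]} := \prod_(i < n.+1) 'X_i ^+ a i in
  let d := (\sum_(i < n.+1) a i)%N in
  exists gamma : unity_tuple k a -> k,
    M = \sum_(e : unity_tuple k a)
          gamma e *:
            ('X_ord0 + \sum_(i < n) (e i : k) *: 'X_(lift ord0 i)) ^+ d
    /\ is_waring_rank d M
         #|{: unity_tuple k a}|.
Proof.
move=> M d.
have natr_neq0 m : (0 < m)%N -> m%:R != 0 :> k.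
  by rewrite (proj1 (pcharf0P k) hchar) lt0n.
pose am : 'X_{1..n.+1} := [multinom a i | i < n.+1].
have M_E : M = 'X_[am].
  by rewrite mpolyXE_id; apply: eq_bigr => i _; rewrite mnmE.
have deg_am : mdeg am = d by rewrite mdegE; apply: eq_bigr => i _; rewrite mnmE.
pose N : k := \prod_(i < n) (a (lift ord0 i)).+1%:R.
have N_neq0 : N != 0 by apply/prodf_neq0 => i _; apply: natr_neq0.
have w_neq0 : (words d am)%:R != 0 :> k.
  by rewrite natr_neq0 // words_gt0 deg_am.
pose gamma (e : unity_tuple k a) : k :=
  (\prod_(i < n) (e i : k)) / ((words d am)%:R * N).
pose L (e : unity_tuple k a) : {mpoly k[n.+1]} :=
  'X_ord0 + \sum_(i < n) (e i : k) *: 'X_(lift ord0 i).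
pose c (e : unity_tuple k a) (i : 'I_n.+1) : k :=
  if unlift ord0 i is Some j then (e j : k) else 1.
have L_E e : L e = \sum_i c e i *: 'X_i.
  rewrite big_ord_recl /c unlift_none scale1r; congr (_ + _).
  by apply: eq_bigr => j _; rewrite liftK.
have decM : M = \sum_e gamma e *: L e ^+ d.
  rewrite M_E; apply/mpolyP => m; rewrite mcoeffX raddf_sum /=.
  transitivity ((words d m)%:R / ((words d am)%:R * N) *
      \prod_(i < n) \sum_(z : unity_root k (a (lift ord0 i)))
        (z : k) ^+ (m (lift ord0 i)).+1); last first.
    rewrite bigA_distr_dffun mulr_sumr; apply: eq_bigr => e _.
    rewrite mcoeffZ L_E mcoeff_linear_form_exp big_ord_recl /c unlift_none.
    rewrite expr1n mul1r; under [in RHS]eq_bigr => j _ do rewrite liftK.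
    under eq_bigr => j _ do rewrite exprS.
    rewrite big_split /= /gamma; ring.
  under eq_bigr => j _ do rewrite sum_unity_root_exp ?natr_neq0 //.
  rewrite big_split /= -/N.
  (* Each sum of powers of roots of unity is [a_j + 1] or 0. *)
  have [<-|m_neq] := eqVneq am m.
    rewrite big1 ?mul1r; last by move=> j _; rewrite mnmE dvdnn.
    by rewrite mulrAC divff // mulf_neq0.
  have [->|] := posnP (words d m); first by rewrite !mul0r.
  rewrite words_gt0 => /eqP deg_m.
  have [/forallP dvd_m|/forallPn[j /negPf ndvd_j]] := boolP
    [forall j : 'I_n, (a (lift ord0 j)).+1 %| (m (lift ord0 j)).+1]%N.
    case/eqP: m_neq; apply/mnmP => i; rewrite mnmE.
    apply/esym/eq_of_dvdn_succ => // [j|]; first exact: ha.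
    by rewrite -mdegE deg_m.
  by rewrite (bigD1 j) //= ndvd_j !mul0r mulr0.
have cardU : #|{: unity_tuple k a}| = (\prod_(i < n) (a (lift ord0 i)).+1)%N.
  rewrite card_dffun; apply: eq_bigr => i _.
  exact/card_unity_root/natr_neq0.
exists gamma; split; first exact: decM; split=> [|t].
  have d_gt0 : (0 < d)%N by rewrite /d big_ord_recl addn_gt0 ha1.
  have /fin_all_exists[r rE] : forall e, exists u : k, u ^+ d = gamma e.
    by move=> e; apply: expr_closed_surj.
  exists (fun i => r (enum_val i) *: L (enum_val i)); split=> [i|].
    apply: rpredZ; rewrite L_E rpred_sum // => j _.
    by rewrite rpredZ // dhomogX /= mdeg1.
  rewrite decM (reindex (@enum_val _ {: unity_tuple k a})) /=; last first.
    exact/onW_bij/enum_val_bij.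
  by apply: eq_bigr => i _; rewrite exprZn rE.
by rewrite cardU; apply: monomial_waring_ge.
Qed.
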